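(* The assignment of the proximity space at infinity $(\mathbf{B}X,\boldsymbol{\delta})$ to an unbounded metric space $(X,d)$, together with the assignment of the map $\mathbf{B}f:\mathbf{B}X\to\mathbf{B}Y$, $\mathbf{B}f([A])=[f(A)]$, to a closeness equivalence class $[f]:X\to Y$ of coarse proximity maps between unbounded metric spaces, makes up a functor $\mathbf{B}$ from the category of unbounded metric spaces whose morphisms are closeness equivalence classes of coarse proximity maps to the category of proximity spaces whose morphisms are proximity maps.
   Context: Here $\mathbb{N}=\{1,2,\dots\}$. Metric coarse proximity. For subsets $A,B$ of a metric space $(X,d)$ put $d(A,B)=\inf\{d(x,y)\mid x\in A, y\in B\}$, with $\inf\emptyset=\infty$. Write $A\,\mathbf{b}\,B$ if there exists $\epsilon<\infty$ such that for all bounded sets $D\subseteq X$, $d(A\setminus D,B\setminus D)<\epsilon$; $\bar{\mathbf{b}}$ denotes the negation of $\mathbf{b}$. Write $A\ll B$ if $A\,\bar{\mathbf{b}}\,(X\setminus B)$. Write $A\,\phi\,B$ if $A\,\mathbf{b}\,B'$ for every unbounded $B'\subseteq B$ and $A'\,\mathbf{b}\,B$ for every unbounded $A'\subseteq A$; $\phi$ is an equivalence relation on the power set of $X$ (for nonempty sets it is the relation of having finite Hausdorff distance). Maps. A function $f:X\to Y$ between metric spaces is a coarse proximity map if it sends bounded sets to bounded sets and $A\,\mathbf{b}\,B$ in $X$ implies $f(A)\,\mathbf{b}\,f(B)$ in $Y$. Two functions $f,g:X\to Y$ are close if $f(A)\,\phi\,g(A)$ for all $A\subseteq X$; closeness is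 an equivalence relation and $[f]$ denotes the closeness class of $f$. Composition of closeness classes is given by $[g]\circ[f]=[g\circ f]$, and the identity morphism is the class of the identity map. Proximities. A proximity on a set $Z$ is a relation $\delta$ on the power set of $Z$ such that for all $A,B,C\subseteq Z$ (with $\bar\delta$ the negation of $\delta$): (i) $A\delta B$ implies $B\delta A$; (ii) $(A\cup B)\delta C$ iff $A\delta C$ or $B\delta C$; (iii) $A\delta B$ implies $A,B\neq\emptyset$; (iv) $A\bar\delta B$ implies that there exists $E\subseteq Z$ with $A\bar\delta E$ and $(Z\setminus E)\bar\delta B$; (v) $A\cap B\neq\emptyset$ implies $A\delta B$. A function $f:(Z,\delta_1)\to(W,\delta_2)$ is a proximity map if $A\delta_1B$ implies $f(A)\delta_2f(B)$. A proximity $\delta_1$ is finer than $\delta_2$ (on the same set) if $A\delta_1B$ implies $A\delta_2B$. For a surjection $f$ from a proximity space $(Z,\delta)$ onto a set $W$, the quotient proximity on $W$ is the finest proximity on $W$ for which $f$ is a proximity map (it always exists). Proximity space at infinity. A sequence $f:\mathbb{N}\to\mathbb{R}$ is adequate if it is positive and $f(n)-f(n-1)>n+1$ for all $n>1$. For $A\subseteq X$, $x_0\in X$ and $f$ adequate, put $U_{x_0}(A,f)=A\cup\bigcup_{n\geq1}\big(\mathscr{B}(A,n)\setminus\mathscr{B}(x_0,f(n))\big)$, where $\mathscr{B}(x,r)$ is the open ball and $\mathscr{B}(A,r)=\bigcup_{x\in A}\mathscr{B}(x,r)$. Let $\mathcal{H}_\infty(X)$ be the set of unbounded subsets of $X$,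 with the proximity $\delta$ defined by: $\mathcal{A}\,\delta\,\mathcal{C}$ iff for every adequate $f$ there are $A\in\mathcal{A}$, $C\in\mathcal{C}$ with $A\ll U_{x_0}(C,f)$ and $C\ll U_{x_0}(A,f)$ (this proximity does not depend on the choice of $x_0$). Let $\mathbf{B}X$ be the set of $\phi$-equivalence classes $[A]$ of unbounded sets $A\subseteq X$, endowed with the quotient proximity $\boldsymbol{\delta}$ induced by the projection $\pi:(\mathcal{H}_\infty(X),\delta)\to\mathbf{B}X$, $A\mapsto[A]$. The pair $(\mathbf{B}X,\boldsymbol{\delta})$ is the proximity space at infinity of $X$. *)

(* Defs.v *)
From HB Require Import structures.
From mathcomp Require Import all_boot all_order all_algebra.
From mathcomp Require Import generic_quotient zify lra.
From mathcomp Require Import boolp classical_sets reals ereal topology.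

Set Implicit Arguments.
Unset Strict Implicit.
Unset Printing Implicit Defensive.

Import Order.TTheory GRing.Theory Num.Theory.
Local Open Scope classical_set_scope.
Local Open Scope quotient_scope.
Local Open Scope ring_scope.

Record category := Category {
  obj :> Type;
  hom : obj -> obj -> Type;
  idm : forall X, hom X X;
  comp : forall X Y Z, hom Y Z -> hom X Y -> hom X Z;
  comp_idl : forall X Y (f : hom X Y), comp (idm Y) f = f;
  comp_idr : forall X Y (f : hom X Y), comp f (idm X) = f;
  compA : forall X Y Z T (h : hom Z T) (g : hom Y Z) (f : hom X Y),
    comp h (comp g f) = comp (comp h g) f
}.
Arguments hom {c} X Y.
Arguments idm {c} X.
Arguments comp {c X Y Z} g f.

Definition is_functor (C D : category) (F0 : C -> D)
    (F1 : forall X Y : C, hom X Y -> hom (F0 X) (F0 Y)) : Prop :=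
  (forall X : C, F1 X X (idm X) = idm (F0 X)) /\
  (forall (X Y Z : C) (g : hom Y Z) (f : hom X Y),
     F1 X Z (comp g f) = comp (F1 Y Z g) (F1 X Y f)).

Section proximity.
Variable Z : Type.
Implicit Types (d : set Z -> set Z -> Prop) (A B C E : set Z).

Record is_proximity d : Prop := IsProximity {
  prox_sym : forall A B, d A B -> d B A;
  proxUl : forall A B C, d (A `|` B) C <-> d A C \/ d B C;
  prox_neq0 : forall A B, d A B -> A !=set0 /\ B !=set0;
  prox_sep : forall A B, ~ d A B -> exists E, ~ d A E /\ ~ d (~` E) B;
  prox_meet : forall A B, A `&` B !=set0 -> d A B
}.

Definition finer d1 d2 : Prop := forall A B, d1 A B -> d2 A B.

Lemma prox_sub d A A' B B' : is_proximity d -> A `<=` A' -> B `<=` B' ->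
  d A B -> d A' B'.
Proof.
move=> pd /setUidPr AA' /setUidPr BB' dAB.
rewrite -AA'; apply/(proxUl pd); left; apply: (prox_sym pd).
by rewrite -BB'; apply/(proxUl pd); left; apply: (prox_sym pd).
Qed.

End proximity.

Definition is_proximity_map (Z W : Type) (d1 : set Z -> set Z -> Prop)
    (d2 : set W -> set W -> Prop) (f : Z -> W) : Prop :=
  forall A B, d1 A B -> d2 (f @` A) (f @` B).

Record proxSpace := ProxSpace {
  prox_sort :> Type;
  prox : set prox_sort -> set prox_sort -> Prop;
  proxP : is_proximity prox
}.
Arguments prox {p} A B.

Record prox_map (Z W : proxSpace) := ProxMap {
  prox_map_fun :> Z -> W;
  prox_mapP : is_proximity_map prox prox prox_map_fun
}.

Lemma prox_map_eq (Z W : proxSpace) (f g : prox_map Z W) : f =1 g -> f = g.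
Proof.
case: f g => f fP [g gP] /= /funext fg; case: _ / fg in gP *.
by congr ProxMap; exact: Prop_irrelevance.
Qed.

Lemma prox_map_id_subproof (Z : proxSpace) :
  is_proximity_map prox prox (@id Z).
Proof. by move=> A B; rewrite !image_id. Qed.

Lemma prox_map_comp_subproof (Z W V : proxSpace) (g : prox_map W V)
  (f : prox_map Z W) : is_proximity_map prox prox (g \o f).
Proof.
by move=> A B dAB; rewrite -(image_comp f g) -(image_comp f g); apply/prox_mapP/prox_mapP.
Qed.

Definition prox_map_id (Z : proxSpace) : prox_map Z Z :=
  ProxMap (@prox_map_id_subproof Z).

Definition prox_map_comp (Z W V : proxSpace) (g : prox_map W V)
    (f : prox_map Z W) : prox_map Z V :=
  ProxMap (prox_map_comp_subproof g f).

Definition Prox : category.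
Proof.
by refine (@Category proxSpace prox_map prox_map_id prox_map_comp _ _ _) => *;
  exact: prox_map_eq.
Defined.

Section quotient_proximity.
Variables (Z : proxSpace) (W : Type) (f : Z -> W).

Definition is_quotient_proximity (d : set W -> set W -> Prop) : Prop :=
  [/\ is_proximity d, is_proximity_map prox d f &
    forall d', is_proximity d' -> is_proximity_map prox d' f -> finer d d'].

(* Farness in the coarsest proximity finer than every proximity making f a
   proximity map. *)
Inductive sup_far : set W -> set W -> Prop :=
| sup_far_base d A B : is_proximity d -> is_proximity_map prox d f ->
    ~ d A B -> sup_far A B
| sup_far_sub A A' B B' : A `<=` A' -> B `<=` B' ->
    sup_far A' B' -> sup_far A B
| sup_farUl A B C : sup_far A C -> sup_far B C -> sup_far (A `|` B) C
| sup_farUr A B C : sup_far A B -> sup_far A C -> sup_far A (B `|` C).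

Lemma sup_far_sym A B : sup_far A B -> sup_far B A.
Proof.
elim=> {A B} [d A B pd fd dAB|A A' B B' AA' BB' _ h|A B C _ h1 _ h2
  |A B C _ h1 _ h2].
- by apply: (sup_far_base pd fd) => /(prox_sym pd).
- exact: sup_far_sub h.
- exact: sup_farUr.
- exact: sup_farUl.
Qed.

Lemma sup_far_disj A B : sup_far A B -> ~ (A `&` B !=set0).
Proof.
elim=> {A B} [d A B pd fd dAB|A A' B B' AA' BB' _ h|A B C _ h1 _ h2
  |A B C _ h1 _ h2].
- by move/(prox_meet pd).
- by move=> [x [/AA' ? /BB' ?]]; apply: h; exists x.
- by move=> [x [[] ? ?]]; [apply: h1|apply: h2]; exists x.
- by move=> [x [? []] ?]; [apply: h1|apply: h2]; exists x.
Qed.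

Lemma sup_far_sep A B : sup_far A B ->
  exists E, sup_far A E /\ sup_far (~` E) B.
Proof.
elim=> {A B} [d A B pd fd dAB|A A' B B' AA' BB' _ [E [h1 h2]]
  |A B C _ [E [h1 h2]] _ [F [k1 k2]]|A B C _ [E [h1 h2]] _ [F [k1 k2]]].
- have [E [h1 h2]] := prox_sep pd dAB.
  by exists E; split; exact: (sup_far_base pd fd).
- by exists E; split; [apply: sup_far_sub h1|apply: sup_far_sub h2].
- exists (E `&` F); split.
    apply: sup_farUl; first by apply: sup_far_sub h1 => // x [].
    by apply: sup_far_sub k1 => // x [].
  by rewrite setCI; exact: sup_farUl.
- exists (E `|` F); split; first exact: sup_farUr.
  rewrite setCU; apply: sup_farUr; first by apply: sup_far_sub h2 => // x [].
  by apply: sup_far_sub k2 => // x [].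
Qed.

Lemma sup_far_map A B : sup_far A B -> ~ prox (f @^-1` A) (f @^-1` B).
Proof.
have pZ := proxP Z.
elim=> {A B} [d A B pd fd dAB|A A' B B' AA' BB' _ h|A B C _ h1 _ h2
  |A B C _ h1 _ h2].
- by move=> /fd h; apply: dAB; apply: prox_sub h => // _ [x ? <-].
- by move=> k; apply: h; apply: prox_sub k => // x; [exact: AA'|exact: BB'].
- by rewrite preimage_setU => /(proxUl pZ)[].
- by rewrite preimage_setU => /(prox_sym pZ)/(proxUl pZ)[] /(prox_sym pZ).
Qed.

Let indiscrete (A B : set W) := A !=set0 /\ B !=set0.

Let indiscreteP : is_proximity indiscrete.
Proof.
split.
- by move=> A B [].
- move=> A B C; split=> [[[x [] ?] ?]|[] [[x ?] ?]].
  + by left; split => //; exists x.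
  + by right; split => //; exists x.
  + by split => //; exists x; left.
  + by split => //; exists x; right.
- by [].
- move=> A B AB; have [A0|A0] := pselect (A !=set0).
    exists set0; split; first by case=> _ [].
    by move=> [_ B0]; apply: AB.
  by exists setT; split; [case|rewrite setCT => -[[]]].
- by move=> A B [x [? ?]]; split; exists x.
Qed.

Let indiscrete_map : is_proximity_map prox indiscrete f.
Proof.
by move=> A B /(prox_neq0 (proxP Z))[[x Ax] [y By]]; split; [exists (f x)|
  exists (f y)]; [exists x|exists y].
Qed.

Lemma quotient_proximity_exists : exists d, is_quotient_proximity d.
Proof.
exists (fun A B => ~ sup_far A B); split; first split.
- by move=> A B + /sup_far_sym.
- move=> A B C; split.
    by move=> h; apply/not_andP => -[? ?]; apply: h; exact: sup_farUl.
  by case=> h k; apply: h; apply: sup_far_sub k.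
- by move=> A B h; apply: contrapT => k; apply: h;
    exact: (sup_far_base indiscreteP indiscrete_map).
- move=> A B /contrapT/sup_far_sep[E [h1 h2]].
  by exists E; split; exact.
- by move=> A B h /sup_far_disj; exact.
- move=> A B dAB /sup_far_map; apply; apply: prox_sub dAB => //.
  + exact: proxP.
  + exact: preimage_image.
  + exact: preimage_image.
- move=> d pd fd A B h; apply: contrapT => k.
  by apply: h; exact: (sup_far_base pd fd).
Qed.

Definition quotient_proximity : set W -> set W -> Prop :=
  projT1 (cid quotient_proximity_exists).

Lemma quotient_proximityP : is_quotient_proximity quotient_proximity.
Proof. exact: projT2 (cid quotient_proximity_exists). Qed.

Definition quotient_proxSpace : proxSpace :=
  @ProxSpace W quotient_proximity
    (let: And3 p _ _ := quotient_proximityP in p).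

End quotient_proximity.

Section coarse_proximity.
Variables (R : realType) (X : metricType R).
Implicit Types (A B C D : set X) (x y : X).

Definition mbounded A : Prop :=
  exists r : R, forall x y, A x -> A y -> mdist x y <= r.

Definition set_dist A B : \bar R :=
  ereal_inf [set (mdist x y)%:E | x in A & y in B].

Definition coarse_near A B : Prop :=
  exists e : R, forall D, mbounded D ->
    (set_dist (A `\` D) (B `\` D) < e%:E)%E.

Definition coarse_sub A B : Prop := ~ coarse_near A (~` B).

Definition phi A B : Prop :=
  (forall B', B' `<=` B -> ~ mbounded B' -> coarse_near A B') /\
  (forall A', A' `<=` A -> ~ mbounded A' -> coarse_near A' B).

(* Sequences indexed by the positive integers; the value f 0 is irrelevant. *)
Definition adequate (f : nat -> R) : Prop :=
  (forall n, (0 < n)%N -> 0 < f n) /\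
  (forall n, (1 < n)%N -> n.+1%:R < f n - f n.-1).

Definition thickening A (r : R) : set X := \bigcup_(x in A) ball x r.

Definition adequate_nbhd (x0 : X) A (f : nat -> R) : set X :=
  A `|` \bigcup_(n in [set n | (0 < n)%N])
    (thickening A n%:R `\` ball x0 (f n)).

Lemma coarse_nearP A B : coarse_near A B <->
  exists e : R, forall D, mbounded D ->
    exists x y, [/\ A x, B y, ~ D x, ~ D y & mdist x y < e].
Proof.
split=> -[e h]; exists e => D /h.
  by move=> /ereal_inf_lt[_ [x [Ax Dx] [y [By Dy] <-]]]; rewrite lte_fin;
    exists x, y.
move=> [x [y [Ax By Dx Dy xy]]]; apply: le_lt_trans (_ : (mdist x y)%:E < _)%E.
  by apply: ereal_inf_lbound; exists x => //; exists y.
by rewrite lte_fin.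
Qed.

Lemma mboundedP x0 A : mbounded A <->
  exists r : R, forall x, A x -> mdist x0 x < r.
Proof.
split=> [[r h]|[r h]]; last first.
  exists (r + r) => x y Ax Ay; apply: le_trans (metric_triangle _ x0 _) _.
  by rewrite metric_sym ltW// ltrD// h.
have [[a Aa]|A0] := pselect (A !=set0); last first.
  by exists 0 => x Ax; case: A0; exists x.
exists (mdist x0 a + r + 1) => x Ax; have := h _ _ Aa Ax.
have := metric_triangle x0 a x; lra.
Qed.

Lemma mbounded_sub A B : A `<=` B -> mbounded B -> mbounded A.
Proof. by move=> AB [r h]; exists r => x y /AB ? /AB; exact: h. Qed.

Lemma mbounded_set0 : mbounded set0. Proof. by exists 0. Qed.

Lemma mboundedU A B : mbounded A -> mbounded B -> mbounded (A `|` B).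
Proof.
have [[a _]|AB0] := pselect ((A `|` B) !=set0); last first.
  by move=> _ _; apply: mbounded_sub mbounded_set0 => x ABx; apply: AB0; exists x.
move=> /(mboundedP a)[r h] /(mboundedP a)[s k]; apply/(mboundedP a).
by exists (Num.max r s) => x [/h|/k]; rewrite lt_max => -> //; rewrite orbT.
Qed.

Lemma mbounded_set1 x : mbounded [set x].
Proof. by exists 0 => _ _ -> ->; rewrite mdistxx. Qed.

Lemma mbounded_thickening A r : mbounded A -> mbounded (thickening A r).
Proof.
have [[a _]|A0] := pselect (A !=set0); last first.
  by move=> _; apply: mbounded_sub mbounded_set0 => x [y Ay]; case: A0; exists y.
move=> /(mboundedP a)[s h]; apply/(mboundedP a); exists (s + r) => x [y Ay].
rewrite ballEmdist /= => yx; have := h _ Ay.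
have := metric_triangle a y x; lra.
Qed.

Lemma unbounded_neq0 A : ~ mbounded A -> A !=set0.
Proof.
move=> h; apply: contrapT => A0; apply: h; apply: mbounded_sub mbounded_set0.
by move=> x Ax; apply: A0; exists x.
Qed.

Lemma unboundedD A D : ~ mbounded A -> mbounded D -> (A `\` D) !=set0.
Proof.
move=> h bD; apply: unbounded_neq0 => k; apply: h.
by apply: mbounded_sub (mboundedU k bD) => x Ax; have [|] := pselect (D x);
  [right|left].
Qed.

Lemma coarse_near_sym A B : coarse_near A B -> coarse_near B A.
Proof.
move=> /coarse_nearP[e h]; apply/coarse_nearP; exists e => D /h[x [y []]] *.
by exists y, x; rewrite metric_sym.
Qed.

Lemma coarse_near_sub A A' B B' : A `<=` A' -> B `<=` B' ->
  coarse_near A B -> coarse_near A' B'.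
Proof.
move=> AA' BB' /coarse_nearP[e h]; apply/coarse_nearP; exists e => D.
by move=> /h[x [y [/AA' ? /BB' ? ? ? ?]]]; exists x, y.
Qed.

Lemma coarse_nearDr A B D : mbounded D -> coarse_near A B ->
  coarse_near A (B `\` D).
Proof.
move=> bD /coarse_nearP[e h]; apply/coarse_nearP; exists e => E bE.
have [x [y [Ax By Dx Dy xy]]] := h _ (mboundedU bD bE).
exists x, y; split=> //; first by split=> // ?; apply: Dy; left.
  by move=> ?; apply: Dx; right.
by move=> ?; apply: Dy; right.
Qed.

Lemma coarse_near_unbounded A B : coarse_near A B -> ~ mbounded A.
Proof. by move=> /coarse_nearP[e h] /h[x [y []]]. Qed.

Lemma coarse_near_refl A : ~ mbounded A -> coarse_near A A.
Proof.
move=> uA; apply/coarse_nearP; exists 1 => D /(unboundedD uA)[x [Ax Dx]].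
by exists x, x; rewrite mdistxx ltr01.
Qed.

Lemma coarse_sub_sub A B B' : B `<=` B' -> coarse_sub A B -> coarse_sub A B'.
Proof. by move=> BB' h k; apply: h; apply: coarse_near_sub k => // x + /BB'. Qed.

Lemma coarse_subUb A B D : mbounded D -> coarse_sub A (B `|` D) ->
  coarse_sub A B.
Proof.
move=> bD h /(coarse_nearDr bD) k; apply: h; apply: coarse_near_sub k => //.
by move=> x [Bx Dx] [].
Qed.

Lemma coarse_subP A B : coarse_sub A B -> mbounded (A `\` B).
Proof.
move=> h; apply: contrapT => /coarse_near_refl k; apply: h.
by apply: coarse_near_sub k => x [].
Qed.

Lemma phi_sym A B : phi A B -> phi B A.
Proof. by move=> [h k]; split=> C ? ?; apply: coarse_near_sym; auto. Qed.

Lemma phi_refl A : phi A A.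
Proof.
by split=> B BA /coarse_near_refl; exact: coarse_near_sub.
Qed.

Lemma phi_bounded A B : phi A B -> mbounded A -> mbounded B.
Proof.
move=> [h _] bA; apply: contrapT => uB.
exact: (coarse_near_unbounded (h _ (@subset_refl _ B) uB)).
Qed.

Lemma phi_within A B : phi A B -> ~ mbounded A ->
  exists r : R, forall x, A x -> exists y, B y /\ mdist x y < r.
Proof.
move=> AB uA; have uB : ~ mbounded B by move=> /(phi_bounded (phi_sym AB)).
have [b Bb] := unbounded_neq0 uB.
apply: contrapT => /forallNP h.
have {h} /choice[a ha] : forall n : nat, exists x,
    A x /\ forall y, B y -> n%:R <= mdist x y.
  move=> n; have /existsNP[x /not_implyP[Ax /forallNP hx]] := h n%:R.
  by exists x; split=> // y By; rewrite leNgt; apply/negP => ?; apply: (hx y).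
have bI k : mbounded [set a n | n in [set n | (n < k)%N]].
  elim: k => [|k ih].
    by apply: mbounded_sub mbounded_set0 => x [].
  apply: mbounded_sub (mboundedU ih (@mbounded_set1 (a k))) => x [n /=].
  rewrite ltnS leq_eqVlt => /orP[/eqP -> <-|? <-]; first by right.
  by left; exists n.
have /coarse_nearP[e he] : coarse_near (range a) B.
  apply: AB.2; first by move=> _ [n _ <-]; exact: (ha n).1.
  move=> /(mboundedP b)[r hr].
  have := hr (a (Num.bound `|r|)) (ex_intro2 _ _ _ I erefl).
  have := (ha (Num.bound `|r|)).2 _ Bb.
  have := archi_boundP (normr_ge0 r); have := ler_norm r.
  rewrite metric_sym; lra.
have [_ [y [[n _ <-] By nD _]]] := he _ (bI (Num.bound `|e|)).
have nb : (Num.bound `|e| <= n)%N.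
  by rewrite leqNgt; apply/negP => nlt; apply: nD; exists n.
have := (ha n).2 _ By; have := archi_boundP (normr_ge0 e).
have := ler_norm e; move: nb; rewrite -(ler_nat R); lra.
Qed.

Lemma phi_of_within A B (r : R) :
  (forall x, A x -> exists y, B y /\ mdist x y < r) ->
  (forall y, B y -> exists x, A x /\ mdist y x < r) -> phi A B.
Proof.
have half C D : (forall x, C x -> exists y, D y /\ mdist x y < r) ->
    forall C', C' `<=` C -> ~ mbounded C' -> coarse_near C' D.
  move=> h C' CC' uC'; apply/coarse_nearP; exists r => E bE.
  have bE' := mboundedU bE (mbounded_thickening r bE).
  have [x [Cx Ex]] := unboundedD uC' bE'.
  have [y [Dy xy]] := h _ (CC' _ Cx).
  exists x, y; split=> // [?|Ey]; first by apply: Ex; left.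
  by apply: Ex; right; exists y => //; rewrite ballEmdist /= metric_sym.
by move=> h k; split=> [C ? ?|C ? ?]; [apply: coarse_near_sym|];
  apply: half; eauto.
Qed.

Lemma phi_trans A B C : phi A B -> phi B C -> phi A C.
Proof.
move=> AB BC; have [bA|uA] := pselect (mbounded A).
  have bC := phi_bounded BC (phi_bounded AB bA).
  by split=> D /mbounded_sub h uD; case: uD; exact: h.
have uB : ~ mbounded B by move=> /(phi_bounded (phi_sym AB)).
have uC : ~ mbounded C by move=> /(phi_bounded (phi_sym BC)).
have [r1 h1] := phi_within AB uA; have [r2 h2] := phi_within BC uB.
have [s1 k1] := phi_within (phi_sym AB) uB.
have [s2 k2] := phi_within (phi_sym BC) uC.
apply: (@phi_of_within _ _ (Num.max (r1 + r2) (s2 + s1))) => [x Ax|z Cz].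
  have [y [By xy]] := h1 _ Ax; have [z [Cz yz]] := h2 _ By.
  exists z; split=> //; rewrite lt_max; apply/orP; left.
  by have := metric_triangle x y z; lra.
have [y [By zy]] := k2 _ Cz; have [x [Ax yx]] := k1 _ By.
exists x; split=> //; rewrite lt_max; apply/orP; right.
by have := metric_triangle z y x; lra.
Qed.

End coarse_proximity.

Section adequate.
Variable R : realType.
Implicit Types f g : nat -> R.

Lemma adequate_mono f m n : adequate f -> (0 < m)%N -> (m <= n)%N -> f m <= f n.
Proof.
move=> [_ h] m0; elim: n => [|n ih]; first by rewrite leqn0 => /eqP ->.
rewrite leq_eqVlt => /orP[/eqP ->//|]; rewrite ltnS => mn.
have := h n.+1; rewrite /= ltnS (leq_trans m0 mn) => /(_ isT).
have := ih mn; have : (0 : R) <= n.+2%:R by []; lra.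
Qed.

Lemma adequate_ge f n : adequate f -> (0 < n)%N -> n%:R - 1 <= f n.
Proof.
move=> [h0 h]; case: n => // n _; elim: n => [|n ih].
  by have := h0 1%N isT; lra.
have := h n.+2 isT; rewrite /= -!natr1.
by move: ih; rewrite -natr1; have : (0 : R) <= n%:R by []; lra.
Qed.

Lemma adequate_exists : exists f, adequate f.
Proof.
exists (fun n => (n.+1 ^ 2)%:R); split=> [n _|[//|n] n1].
  by rewrite ltr0n expn_gt0.
rewrite ltrBrDr -natrD ltr_nat /=.
rewrite -[n.+2]addn1 sqrnD; lia.
Qed.

Lemma adequate_max f g : adequate f -> adequate g ->
  adequate (fun n => Num.max (f n) (g n)).
Proof.
move=> [f0 fS] [g0 gS]; split=> n n0; first by rewrite lt_max f0.
have := fS _ n0; have := gS _ n0.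
by case: (lerP (f n.-1) (g n.-1)) => _ hg hf; rewrite ltrBrDr lt_max;
  apply/orP; [right|left]; rewrite -ltrBrDr.
Qed.

Lemma adequate_double f : adequate f -> adequate (fun n => f n.*2 + n%:R).
Proof.
move=> af; have [f0 fS] := af; split=> [n n0|[//|n] n1].
  by rewrite ltr_wpDr// f0// double_gt0.
rewrite /= doubleS.
have := fS n.*2.+2 isT; have := adequate_mono af _ (leqnSn n.*2.+1) => /(_ isT).
have := adequate_mono af _ (leqnSn n.*2); rewrite double_gt0 => /(_ n1).
rewrite /= -!natr1 -addnn natrD.
have : (0 : R) <= n%:R by []; lra.
Qed.

End adequate.

Section adequate_nbhd.
Variables (R : realType) (X : metricType R) (x0 : X).
Implicit Types (A B D : set X) (f g : nat -> R).
Local Notation U := (adequate_nbhd x0).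

Lemma adequate_nbhdP A f y : U A f y <-> A y \/
  exists n a, [/\ (0 < n)%N, A a, mdist a y < n%:R & f n <= mdist x0 y].
Proof.
split=> [[Ay|[n /= n0 [[a Aa]]]]|[Ay|[n [a [n0 Aa ay fy]]]]].
- by left.
- rewrite !ballEmdist /= => ay /negP; rewrite -leNgt => fy.
  by right; exists n, a.
- by left.
- right; exists n => //; split; first by exists a; rewrite ?ballEmdist.
  by rewrite ballEmdist /=; apply/negP; rewrite -leNgt.
Qed.

Lemma adequate_nbhd_sub A B f : A `<=` B -> U A f `<=` U B f.
Proof.
move=> AB y /adequate_nbhdP h; apply/adequate_nbhdP.
case: h => [/AB ?|[n [a [n0 /AB ? ? ?]]]]; first by left.
by right; exists n, a.
Qed.

Lemma adequate_nbhd_anti A f g : (forall n, f n <= g n) -> U A g `<=` U A f.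
Proof.
move=> fg y /adequate_nbhdP h; apply/adequate_nbhdP.
case: h => [?|[n [a [n0 ? ? gy]]]]; first by left.
by right; exists n, a; split=> //; exact: le_trans gy.
Qed.

Lemma adequate_nbhdU A B f : U (A `|` B) f `<=` U A f `|` U B f.
Proof.
move=> y /adequate_nbhdP[[?|?]|[n [a [n0 [Aa|Ba] ay fy]]]].
- by left; apply/adequate_nbhdP; left.
- by right; apply/adequate_nbhdP; left.
- by left; apply/adequate_nbhdP; right; exists n, a.
- by right; apply/adequate_nbhdP; right; exists n, a.
Qed.

Lemma mbounded_adequate_nbhd D f : adequate f -> mbounded D ->
  mbounded (U D f).
Proof.
move=> af /(mboundedP x0)[r hr]; set N := (Num.bound `|r|).+3.
have Nr : r < N%:R - 3.
  have := archi_boundP (normr_ge0 r); have := ler_norm r.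
  by rewrite /N -!natr1; lra.
apply/(mboundedP x0); exists (r + N%:R) => y /adequate_nbhdP[Dy|].
  have := hr _ Dy; have : (0 : R) <= N%:R by []; lra.
move=> [n [a [n0 Da ay fy]]]; have := hr _ Da.
have [nN|Nn] := leqP n N.
  move: nN; rewrite -(ler_nat R) => nN ar.
  have := metric_triangle x0 a y; lra.
move=> ar; have := metric_triangle x0 a y.
have n1 : (1 < n)%N by exact: leq_trans Nn.
have := af.2 _ n1.
have := adequate_ge af (_ : 0 < n.-1)%N; rewrite -ltnS prednK// => /(_ n1).
have -> : n.-1%:R = n%:R - 1 :> R by rewrite -subn1 natrB.
move: Nn; rewrite -(ltr_nat R) -natr1; lra.
Qed.

Lemma adequate_nbhd_refl A f : adequate f -> coarse_sub A (U A f).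
Proof.
move=> af /coarse_nearP[e he]; set N := (Num.bound `|e|).+1.
have [|x [y [Ax Uy _ yD xy]]] := he (ball x0 (f N)).
  by apply/(mboundedP x0); exists (f N) => x; rewrite ballEmdist.
apply: Uy; apply/adequate_nbhdP; right; exists N, x; split=> //.
  apply: lt_trans xy _; have := archi_boundP (normr_ge0 e).
  by have := ler_norm e; rewrite /N -natr1; lra.
by rewrite leNgt; apply/negP; move: yD; rewrite ballEmdist.
Qed.

Lemma adequate_nbhd_double A f : adequate f ->
  U (U A (fun n => f n.*2 + n%:R)) (fun n => f n.*2 + n%:R) `<=` U A f.
Proof.
move=> af y; set g := fun n => _.
have fg n : (0 < n)%N -> f n <= f n.*2 + n%:R.
  move=> n0; rewrite ler_wpDr//; apply: (adequate_mono af) => //.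
  by rewrite -addnn leq_addr.
have Uf B z n a : (0 < n)%N -> B a -> mdist a z < n%:R -> g n <= mdist x0 z ->
    U B f z.
  move=> n0 Ba az gz; apply/adequate_nbhdP; right; exists n, a; split=> //.
  exact: le_trans (fg _ n0) _.
move=> /adequate_nbhdP[/adequate_nbhdP[Ay|]|].
- by apply/adequate_nbhdP; left.
- by move=> [n [a [n0 Aa ay gy]]]; exact: (Uf A y n a).
move=> [n [z [n0 /adequate_nbhdP[Az|[m [a [m0 Aa az gz]]]] zy gy]]].
  exact: (Uf A y n z).
apply/adequate_nbhdP; right; have := metric_triangle a z y.
have := metric_triangle x0 y z; rewrite (metric_sym y z) => t1 t2.
rewrite /g in gy gz; have : (0 : R) <= n%:R by []; move=> nn.
have [nm|/ltnW mn] := leqP n m.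
  exists m.*2, a; rewrite double_gt0 m0; split=> //.
    by move: nm; rewrite -(ler_nat R) -addnn natrD; lra.
  by move: nm; rewrite -(ler_nat R); lra.
exists n.*2, a; rewrite double_gt0 n0; split=> //.
  by move: mn; rewrite -(ler_nat R) -addnn natrD; lra.
by lra.
Qed.

End adequate_nbhd.

Section infinity.
Variables (R : realType) (X : metricType R).

Record unbounded_set := UnboundedSet {
  uset :> set X;
  usetP : ~ mbounded uset
}.

HB.instance Definition _ := gen_eqMixin unbounded_set.
HB.instance Definition _ := gen_choiceMixin unbounded_set.

Definition phib : rel unbounded_set := fun A B => `[< phi A B >].

Lemma phib_refl : reflexive phib.
Proof. by move=> A; apply/asboolP; exact: phi_refl. Qed.

Lemma phib_sym : symmetric phib.
Proof.
by move=> A B; apply/idP/idP => /asboolP h; apply/asboolP; exact: phi_sym.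
Qed.

Lemma phib_trans : transitive phib.
Proof.
move=> B A C /asboolP h /asboolP k; apply/asboolP; exact: phi_trans h k.
Qed.

Canonical phi_equiv := EquivRel phib phib_refl phib_sym phib_trans.

Definition phi_classes := {eq_quot phi_equiv}.

Definition phi_class (A : unbounded_set) : phi_classes := \pi A.

Variable x0 : X.
Local Notation U := (adequate_nbhd x0).

(* Relative to an explicit base point x0. *)
Definition hyper_prox (P Q : set unbounded_set) : Prop :=
  forall f : nat -> R, adequate f -> exists A C : unbounded_set,
    [/\ P A, Q C, coarse_sub A (U C f) & coarse_sub C (U A f)].

Lemma coarse_sub_double A C E f : adequate f ->
  coarse_sub A (U E (fun n => f n.*2 + n%:R)) ->
  coarse_sub E (U C (fun n => f n.*2 + n%:R)) -> coarse_sub A (U C f).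
Proof.
move=> af; set g := fun n => _ => AE EC; have ag : adequate g.
  exact: adequate_double.
have bD := mbounded_adequate_nbhd x0 ag (coarse_subP EC).
apply: (coarse_subUb bD); apply: coarse_sub_sub AE => y Uy.
have EU : E `<=` U C g `|` (E `\` U C g).
  by move=> x Ex; have [|] := pselect (U C g x); [left|right].
have [h|] := adequate_nbhdU (adequate_nbhd_sub EU Uy); last by right.
by left; exact: adequate_nbhd_double h.
Qed.

Lemma hyper_proxP : is_proximity hyper_prox.
Proof.
split.
- by move=> P Q h f /h[A [C [? ? ? ?]]]; exists C, A.
- move=> P Q S; split=> [h|]; last first.
    by move=> [] h f /h[A [C [? ? ? ?]]]; exists A, C; split=> //;
      [left|right].
  apply: contrapT => /not_orP[/existsNP[f /not_implyP[af hf]]].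
  move=> /existsNP[g /not_implyP[ag hg]].
  have [A [C [PQA SC AC CA]]] := h _ (adequate_max af ag).
  have lf B : U B (fun n => Num.max (f n) (g n)) `<=` U B f.
    by apply: adequate_nbhd_anti => n; rewrite le_max lexx.
  have lg B : U B (fun n => Num.max (f n) (g n)) `<=` U B g.
    by apply: adequate_nbhd_anti => n; rewrite le_max lexx orbT.
  by case: PQA => ?; [apply: hf|apply: hg]; exists A, C; split=> //;
    apply: coarse_sub_sub (_ : coarse_sub _ (U _ (fun n => Num.max (f n) (g n))));
    eauto.
- move=> P Q h; have [f /h[A [C [? ? _ _]]]] := adequate_exists R.
  by split; [exists A|exists C].
- move=> P Q /existsNP[f /not_implyP[af hf]].
  have ag := adequate_double af; set g := fun n => _ in ag.
  exists [set E : unbounded_set | exists C : unbounded_set,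
    [/\ Q C, coarse_sub E (U C g) & coarse_sub C (U E g)]]; split.
    move=> /(_ _ ag)[A [E [PA [C [QC EC CE]] AE EA]]].
    apply: hf; exists A, C; split=> //.
      exact: coarse_sub_double af AE EC.
    exact: coarse_sub_double af CE EA.
  by move=> /(_ _ ag)[E [C [nE QC EC CE]]]; apply: nE; exists C.
- move=> P Q [A [PA QA]] f af; exists A, A; split=> //;
    exact: adequate_nbhd_refl.
Qed.

Definition hyperspace : proxSpace := ProxSpace hyper_proxP.

Definition space_at_infinity : proxSpace :=
  @quotient_proxSpace hyperspace phi_classes phi_class.

End infinity.
Arguments unbounded_set {R} X.

Section coarse_map.
Variable R : realType.
Implicit Types X Y Z : metricType R.

Record coarse_map X Y := CoarseMap {
  coarse_map_fun :> X -> Y;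
  coarse_map_bounded : forall A, mbounded A -> mbounded (coarse_map_fun @` A);
  coarse_map_near : forall A B, coarse_near A B ->
    coarse_near (coarse_map_fun @` A) (coarse_map_fun @` B)
}.

Definition close X Y (f g : X -> Y) : Prop :=
  forall A, phi (f @` A) (g @` A).

Lemma coarse_map_id_bounded X (A : set X) : mbounded A -> mbounded (id @` A).
Proof. by rewrite image_id. Qed.

Lemma coarse_map_id_near X (A B : set X) :
  coarse_near A B -> coarse_near (id @` A) (id @` B).
Proof. by rewrite !image_id. Qed.

Definition coarse_map_id X : coarse_map X X :=
  CoarseMap (@coarse_map_id_bounded X) (@coarse_map_id_near X).

Section comp.
Variables (X Y Z : metricType R) (g : coarse_map Y Z) (f : coarse_map X Y).

Lemma coarse_map_comp_bounded A : mbounded A -> mbounded ((g \o f) @` A).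
Proof.
by rewrite -(image_comp f g) => ?; do 2 apply: coarse_map_bounded.
Qed.

Lemma coarse_map_comp_near A B :
  coarse_near A B -> coarse_near ((g \o f) @` A) ((g \o f) @` B).
Proof.
by rewrite -(image_comp f g) -(image_comp f g) => ?;
  do 2 apply: coarse_map_near.
Qed.

Definition coarse_map_comp : coarse_map X Z :=
  CoarseMap coarse_map_comp_bounded coarse_map_comp_near.

End comp.

Lemma coarse_map_unbounded X Y (f : coarse_map X Y) (A : set X) :
  ~ mbounded A -> ~ mbounded (f @` A).
Proof.
by move=> /coarse_near_refl/(coarse_map_near f)/coarse_near_unbounded.
Qed.

Definition unbounded_image X Y (f : coarse_map X Y) (A : unbounded_set X) :
    unbounded_set Y :=
  UnboundedSet (coarse_map_unbounded (f := f) (@usetP _ _ A)).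

Lemma coarse_map_phi X Y (f : coarse_map X Y) (A B : set X) :
  phi A B -> phi (f @` A) (f @` B).
Proof.
have half C D : (forall D', D' `<=` D -> ~ mbounded D' -> coarse_near C D') ->
    forall D', D' `<=` f @` D -> ~ mbounded D' -> coarse_near (f @` C) D'.
  move=> h D' D'D uD'; have D'E : D' = f @` (D `&` f @^-1` D').
    apply/seteqP; split=> [y D'y|_ [x [_ ?] <-]//].
    by have [x Dx fx] := D'D _ D'y; exists x => //; split=> //=; rewrite fx.
  rewrite D'E; apply: coarse_map_near; apply: h; first by move=> x [].
  by move=> /(coarse_map_bounded f); rewrite -D'E.
move=> [h k]; split; first exact: half.
move=> A' A'A uA'; apply: coarse_near_sym; apply: (half B A) => //.
by move=> C CA uC; apply: coarse_near_sym; exact: k.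
Qed.

Section closeness_classes.
Variables X Y : metricType R.

HB.instance Definition _ := gen_eqMixin (coarse_map X Y).
HB.instance Definition _ := gen_choiceMixin (coarse_map X Y).

Definition closeb : rel (coarse_map X Y) := fun f g => `[< close f g >].

Lemma closeb_refl : reflexive closeb.
Proof. by move=> f; apply/asboolP => A; exact: phi_refl. Qed.

Lemma closeb_sym : symmetric closeb.
Proof.
by move=> f g; apply/idP/idP => /asboolP h; apply/asboolP => A;
  apply: phi_sym.
Qed.

Lemma closeb_trans : transitive closeb.
Proof.
by move=> g f h /asboolP fg /asboolP gh; apply/asboolP => A;
  exact: phi_trans (fg A) (gh A).
Qed.

Canonical close_equiv := EquivRel closeb closeb_refl closeb_sym closeb_trans.

Definition close_classes := {eq_quot close_equiv}.

Definition close_class (f : coarse_map X Y) : close_classes := \pi f.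

Lemma close_classP f g : close_class f = close_class g <-> close f g.
Proof. by split=> [/eqmodP/asboolP//|h]; apply/eqmodP/asboolP. Qed.

Lemma close_class_surj c : exists f, c = close_class f.
Proof. by exists (repr c); rewrite /close_class reprK. Qed.

End closeness_classes.

(* Defined on representatives; close_compE gives [g] o [f] = [g o f] for all
   representatives. *)
Definition close_comp X Y Z (d : close_classes Y Z) (c : close_classes X Y) :
    close_classes X Z :=
  close_class (coarse_map_comp (repr d) (repr c)).

Lemma close_compE X Y Z (g : coarse_map Y Z) (f : coarse_map X Y) :
  close_comp (close_class g) (close_class f) =
  close_class (coarse_map_comp g f).
Proof.
set g' := repr (close_class g); set f' := repr (close_class f).
have hg : close g' g by apply/close_classP; rewrite /close_class reprK.
have hf : close f' f by apply/close_classP; rewrite /close_class reprK.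
apply/close_classP => A; rewrite /= -(image_comp f' g') -(image_comp f g).
exact: phi_trans (coarse_map_phi _ (hf A)) (hg _).
Qed.

Record unboundedMetricType := UnboundedMetric {
  umetric_sort :> metricType R;
  umetricP : ~ mbounded [set: umetric_sort]
}.

Definition UMet : category.
Proof.
refine (@Category unboundedMetricType
  (fun X Y : unboundedMetricType => close_classes X Y)
  (fun X : unboundedMetricType => close_class (coarse_map_id X))
  (fun X Y Z : unboundedMetricType => @close_comp X Y Z) _ _ _).
- move=> X Y c; have [f ->] := close_class_surj c.
  by rewrite close_compE; apply/close_classP => A; exact: phi_refl.
- move=> X Y c; have [f ->] := close_class_surj c.
  by rewrite close_compE; apply/close_classP => A; exact: phi_refl.
- move=> X Y Z T c3 c2 c1; have [h ->] := close_class_surj c3.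
  have [g ->] := close_class_surj c2; have [f ->] := close_class_surj c1.
  by rewrite !close_compE; apply/close_classP => A; exact: phi_refl.
Defined.

End coarse_map.

(* Main.v *)
(** A coarse proximity map [f] is bornologous and proper.  These two moduli turn
    a growth rate [g] on [Y] into a growth rate [h] on [X] such that
    [A `\` U C h] bounded implies [f A << U (f C) g]; hence taking images is a
    proximity map between the hyperspaces.  It descends to the quotients
    because the pullback of a proximity along any map is again a proximity, so
    that the quotient proximity is finer than the pullback along [B f] of the
    proximity of [B Y]. *)

From mathcomp Require Import all_boot all_order all_algebra.
From mathcomp Require Import generic_quotient lra.
From mathcomp Require Import boolp classical_sets reals topology.
Require Import Defs.

Set Implicit Arguments.
Unset Strict Implicit.
Unset Printing Implicit Defensive.

Import Order.TTheory GRing.Theory Num.Theory.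
Local Open Scope classical_set_scope.
Local Open Scope ring_scope.

(** * Pullback of proximities, and growth rates made adequate *)

Lemma pullback_proximity (Z W : Type) (d : set W -> set W -> Prop) (f : Z -> W) :
  is_proximity d -> is_proximity (fun A B => d (f @` A) (f @` B)).
Proof.
move=> pd; split.
- by move=> A B; exact: (prox_sym pd).
- by move=> A B C; rewrite image_setU; exact: (proxUl pd).
- by move=> A B /(prox_neq0 pd)[[_ [x Ax _]] [_ [y By _]]]; split;
    [exists x|exists y].
- move=> A B /(prox_sep pd)[E [AE EB]]; exists (f @^-1` E); split.
    by apply: contra_not AE; apply: (prox_sub pd) => // _ [x ? <-].
  by apply: contra_not EB; apply: (prox_sub pd) => // _ [x ? <-].
- move=> A B [x [Ax Bx]]; apply: (prox_meet pd).
  by exists (f x); split; exists x.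
Qed.

Lemma quotient_proximity_lift (Z V : proxSpace) (W : Type) (p : Z -> W)
    (g : W -> V) :
  is_proximity_map prox prox (g \o p) ->
  is_proximity_map (quotient_proximity p) prox g.
Proof.
move=> gp; have [_ _ h] := quotient_proximityP p.
apply: (h _ (pullback_proximity g (proxP V))) => A B /gp.
by rewrite -!(image_comp p g).
Qed.

Lemma adequate_dominating (R : realType) (k : nat -> R) :
  exists2 h : nat -> R, adequate h & forall n, k n <= h n.
Proof.
(* The summand [i.+2] pushes the [n]-th increment above the required [n.+1]; the absolute values
   give domination. *)
pose h n := \sum_(i < n.+1) (`|k i| + i.+2%:R).
have hS n : h n.+1 = h n + (`|k n.+1| + n.+3%:R) by rewrite /h big_ord_recr.
have h0 n : 0 <= h n by apply: sumr_ge0 => i _; rewrite addr_ge0.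
exists h => [|n].
  split=> -[//|n] _; rewrite hS.
    by rewrite ltr_wpDl// ltr_wpDl.
  by rewrite addrAC subrr add0r ltr_wpDl// ltr_nat.
rewrite /h big_ord_recr /=; have := ler_norm (k n).
have : (0 : R) <= n.+2%:R by [].
have : 0 <= \sum_(i < n) (`|k i| + i.+2%:R).
  by apply: sumr_ge0 => i _; rewrite addr_ge0.
lra.
Qed.

Lemma lt_posnat_exists (R : realType) (r : R) : exists2 n, (0 < n)%N & r < n%:R.
Proof.
exists (Num.bound `|r|).+1 => //; apply: le_lt_trans (ler_norm r) _.
by apply: lt_trans (archi_boundP (normr_ge0 r)) _; rewrite ltr_nat.
Qed.

(** * Moduli of a coarse proximity map and its action on unbounded sets *)

Section coarse_maps.
Variables (R : realType) (X Y : metricType R) (f : coarse_map X Y).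

(** An unbounded preimage of a ball would have an unbounded image. *)
Lemma coarse_map_proper (x0 : X) (y0 : Y) (r : R) :
  exists s : R, forall x, mdist y0 (f x) < r -> mdist x0 x < s.
Proof.
have : mbounded [set x | mdist y0 (f x) < r].
  apply: contrapT => /(coarse_map_unbounded (f := f)); apply.
  by apply/(mboundedP y0); exists r => _ [x ? <-].
by move=> /(mboundedP x0).
Qed.

Lemma coarse_map_bounded_ball (x0 : X) (y0 : Y) (s : R) :
  exists r : R, forall x, mdist x0 x < s -> mdist y0 (f x) < r.
Proof.
have : mbounded (f @` [set x | mdist x0 x < s]).
  by apply: coarse_map_bounded; apply/(mboundedP x0); exists s.
by move=> /(mboundedP y0)[r hr]; exists r => x ?; apply: hr; exists x.
Qed.

(* Otherwise one chooses [x n, y n] at distance less than [r] with images at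
   distance at least [n], so sparsely that also [f (x m)] and [f (y n)] are at
   distance at least [m]; then [range x] and [range y] are near, but
   their images are not. *)
Lemma coarse_map_bornologous (r : R) :
  exists s : R, forall x y, mdist x y < r -> mdist (f x) (f y) < s.
Proof.
apply: contrapT => /forallNP nb.
have [[o _]|X0] := pselect ([set: X] !=set0); last first.
  by apply: (nb 0) => x; case: X0; exists x.
have /choice[w hw] : forall s : R, exists p : X * X,
    [/\ mdist p.1 p.2 < r, s <= mdist (f p.1) (f p.2),
      s <= mdist (f o) (f p.1) & s <= mdist (f o) (f p.2)].
  (* If one image lay within [s] of [f o], both points would lie within [t + r] of [o], so the
     images would be less than [u + u] apart. *)
  move=> s; have [t ht] := coarse_map_proper o (f o) s.
  have [u hu] := coarse_map_bounded_ball o (f o) (t + r).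
  have /existsNP[x /existsNP[y /not_implyP[xy fxy]]] := nb (Num.max s (u + u)).
  have {fxy} : Num.max s (u + u) <= mdist (f x) (f y).
    by rewrite leNgt; exact/negP.
  rewrite ge_max => /andP[sxy uxy].
  have r0 : 0 < r by apply: le_lt_trans xy; exact: mdist_ge0.
  have tri := metric_triangle (f x) (f o) (f y).
  have trixy := metric_triangle o x y.
  have triyx := metric_triangle o y x.
  rewrite (metric_sym y x) in triyx; rewrite (metric_sym (f x) (f o)) in tri.
  exists (x, y); split=> //=; rewrite leNgt; apply/negP => /ht small.
  - have := hu x; have := hu y; lra.
  - have := hu x; have := hu y; lra.
(* Each threshold exceeds the last by the distances of the images just chosen from [f o], so later
   images avoid all earlier ones. *)
pose size_of (p : X * X) := mdist (f o) (f p.1) + mdist (f o) (f p.2).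
pose step (n : nat) (s : R) := s + size_of (w s) + n.+1%:R.
pose s := fix s n := if n is n'.+1 then step n' (s n') else 0.
pose x n := (w (s n)).1; pose y n := (w (s n)).2.
have size0 p : 0 <= size_of p by rewrite addr_ge0// mdist_ge0.
have sS n : s n.+1 = s n + size_of (w (s n)) + n.+1%:R by [].
have s_ge n : n%:R <= s n.
  case: n => [//|n]; rewrite sS lerDr addr_ge0//.
  elim: n => [//|n ih]; rewrite sS; have := size0 (w (s n)).
  by have : (0 : R) <= n.+1%:R by []; lra.
have s_gap m n : (m < n)%N -> size_of (w (s m)) + n%:R <= s n.
  elim: n => [//|n ih]; rewrite ltnS leq_eqVlt => /orP[/eqP ->|mn].
    by rewrite sS; have := s_ge n; have : (0 : R) <= n%:R by []; lra.
  rewrite sS; have := ih mn; have := size0 (w (s n)).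
  by have : (0 : R) <= n%:R by []; lra.
have far m n : m%:R <= mdist (f (x m)) (f (y n)).
  have [_ smm smx smy] := hw (s m); have [_ _ snx sny] := hw (s n).
  have := s_ge m; have := mdist_ge0 (f o) (f (w (s m)).2).
  have := mdist_ge0 (f o) (f (w (s n)).1); rewrite /x /y.
  have := metric_triangle (f o) (f (x m)) (f (y n)).
  have := metric_triangle (f o) (f (y n)) (f (x m)).
  move: smm; rewrite (metric_sym (f (y n))) /x /y.
  have [mn|nm|->] := ltngtP m n; last by lra.
    have := s_gap _ _ mn; rewrite /size_of.
    by move: mn; rewrite -(ltr_nat R); lra.
  by have := s_gap _ _ nm; rewrite /size_of; lra.
have /(coarse_map_near f)/coarse_nearP[e he] : coarse_near (range x) (range y).
  apply/coarse_nearP; exists r => D.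
  (* The image of [D] lies in a ball that the images of a late pair leave. *)
  move=> /(coarse_map_bounded f)/(mboundedP (f o))[t ht].
  have [n _ tn] := lt_posnat_exists t; have [xy _ snx sny] := hw (s n).
  have sn := s_ge n.
  by exists (x n), (y n); split=> // Dn;
    have := ht _ (ex_intro2 _ _ _ Dn erefl); rewrite /x /y; lra.
have [N N0 eN] := lt_posnat_exists e.
(* Outside this ball only points [f (x m)] with [N <= m] remain, and [far] then exceeds [e]. *)
have [|_ [_ [[_ [m _ <-] <-] [_ [n _ <-] <-] xD _]]] :=
    he [set z | mdist (f o) z < s N].
  by apply/(mboundedP (f o)); exists (s N).
apply/negP; rewrite -leNgt; apply: le_trans (far m n).
have Nm : (N <= m)%N.
  rewrite leqNgt; apply/negP => /s_gap; rewrite /size_of => mN; apply: xD => /=.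
  move: N0; rewrite -(ltr_nat R).
  have := mdist_ge0 (f o) (f (w (s m)).2); rewrite /x; lra.
by apply: ltW; apply: lt_le_trans eN _; rewrite ler_nat.
Qed.

(** If [a] is within [n] of [c], a point [y] near [f a] is within [rho n] plus a constant of [f c].
    The rate [h] grows so fast that [y] is then beyond the radius [g] demands. *)
Lemma image_coarse_sub_adequate_nbhd (x0 : X) (y0 : Y) (g : nat -> R) :
  adequate g -> exists2 h, adequate h &
    forall A C, mbounded (A `\` adequate_nbhd x0 C h) ->
      coarse_sub (f @` A) (adequate_nbhd y0 (f @` C) g).
Proof.
move=> ag.
have /choice[rho rhoP] : forall n : nat, exists m : nat, forall x y,
    mdist x y < n%:R -> mdist (f x) (f y) < m%:R.
  move=> n; have [s hs] := coarse_map_bornologous n%:R.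
  have [m _ sm] := lt_posnat_exists s.
  by exists m => x y /hs /lt_trans; apply.
have /choice[k kP] : forall n : nat, exists s : R, forall x,
    mdist y0 (f x) < g (rho n + n)%N + n%:R -> mdist x0 x < s.
  by move=> n; exact: coarse_map_proper.
have [h ah kh] := adequate_dominating k; exists h => // A C bAC.
move=> /coarse_nearP[e he]; have [N N0 eN] := lt_posnat_exists e.
have [t ht] := coarse_map_bounded_ball x0 y0 (h N).
(* The bound [t] forces [h N <= mdist x0 a]; the other term settles the case where [a] lies in
   [C]. *)
have bD : mbounded [set z | mdist y0 z < Num.max t (g N + N%:R)].
  by apply/(mboundedP y0); exists (Num.max t (g N + N%:R)).
have [_ [y [[a Aa <-] yU aD yD ay]]] :=
  he _ (mboundedU (coarse_map_bounded f bAC) bD).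
have [aM yM] : Num.max t (g N + N%:R) <= mdist y0 (f a) /\
    Num.max t (g N + N%:R) <= mdist y0 y.
  by split; rewrite leNgt; apply/negP => ?; [apply: aD|apply: yD]; right.
move: aM yM; rewrite !ge_max => /andP[ta _] /andP[_ gy].
have aU : adequate_nbhd x0 C h a.
  by apply: contrapT => aU; apply: aD; left; exists a.
have hNa : h N <= mdist x0 a.
  by rewrite leNgt; apply/negP => /ht; rewrite ltNge ta.
apply: yU; apply/adequate_nbhdP; right.
move: aU => /adequate_nbhdP[Ca|[n [c [n0 Cc ca ha]]]].
  exists N, (f a); split=> //.
    exact: lt_trans ay eN.
  by apply: le_trans gy; rewrite lerDl.
(* Both [h n] and [h N] bound [mdist x0 a] from below, so [h m] does; [N <= m] absorbs the distance
   from [f a] to [y]. *)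
pose m := maxn n N.
have mN : N%:R <= m%:R :> R by rewrite ler_nat leq_maxr.
have hma : h m <= mdist x0 a by rewrite /m; case: leqP.
have fca : mdist (f c) (f a) < (rho m)%:R.
  by apply/rhoP/(lt_le_trans ca); rewrite ler_nat leq_maxl.
have gfa : g (rho m + m)%N + m%:R <= mdist y0 (f a).
  by rewrite leNgt; apply/negP => /kP; rewrite ltNge (le_trans (kh m) hma).
have tc := metric_triangle (f c) (f a) y.
have ty := metric_triangle y0 y (f a); rewrite (metric_sym y) in ty.
exists (rho m + m)%N, (f c); split; first by rewrite addn_gt0 leq_max n0 !orbT.
- by exists c.
- rewrite natrD; lra.
- lra.
Qed.

Lemma image_hyper_prox (x0 : X) (y0 : Y) :
  is_proximity_map (hyper_prox x0) (hyper_prox y0) (unbounded_image f).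
Proof.
move=> P Q PQ g /(image_coarse_sub_adequate_nbhd x0 y0)[h ah hP].
have [A [C [PA QC /coarse_subP AC /coarse_subP CA]]] := PQ _ ah.
exists (unbounded_image f A), (unbounded_image f C).
by split; [exists A|exists C|exact: hP|exact: hP].
Qed.

End coarse_maps.

(** * The induced map on classes and functoriality *)

Section map_at_infinity.
Variable R : realType.

Lemma phi_classP (X : metricType R) (A B : unbounded_set X) :
  phi_class A = phi_class B <-> phi A B.
Proof. by split=> [/eqmodP/asboolP//|h]; apply/eqmodP/asboolP. Qed.

Lemma phi_class_surj (X : metricType R) (p : phi_classes X) :
  exists A, p = phi_class A.
Proof. by exists (repr p); rewrite /phi_class reprK. Qed.

Definition map_at_infinity (X Y : metricType R) (c : close_classes X Y)
    (p : phi_classes X) : phi_classes Y :=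
  phi_class (unbounded_image (repr c) (repr p)).

(** Independence of both representatives: coarse maps preserve [phi], and close maps have
    [phi]-related images. *)
Lemma map_at_infinityE (X Y : metricType R) (f : coarse_map X Y)
    (A : unbounded_set X) :
  map_at_infinity (close_class f) (phi_class A) =
  phi_class (unbounded_image f A).
Proof.
apply/phi_classP => /=.
have hf : close (repr (close_class f)) f.
  by apply/close_classP; rewrite /close_class reprK.
have hA : phi (repr (phi_class A)) A.
  by apply/phi_classP; rewrite /phi_class reprK.
exact: phi_trans (coarse_map_phi _ hA) (hf _).
Qed.

Lemma map_at_infinity_prox (X Y : metricType R) (x0 : X) (y0 : Y)
    (c : close_classes X Y) :
  @is_proximity_map (space_at_infinity x0) (space_at_infinity y0)
    prox prox (map_at_infinity c).
Proof.
apply: (@quotient_proximity_lift (hyperspace x0) (space_at_infinity y0)).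
have [f ->] := close_class_surj c.
have [_ pi_prox _] := quotient_proximityP (Z := hyperspace y0) (@phi_class R Y).
move=> P Q /(image_hyper_prox f y0)/pi_prox.
(* Taking images commutes with the projections to classes. *)
have -> : map_at_infinity (close_class f) \o @phi_class R X =
    @phi_class R Y \o unbounded_image f.
  by apply/funext => A; exact: map_at_infinityE.
by rewrite !(image_comp (unbounded_image f)).
Qed.

End map_at_infinity.

Theorem corollary8p24 (R : realType) (x0 : forall X : unboundedMetricType R, X) :
  exists Bmap : forall X Y : UMet R, hom X Y ->
      @hom Prox (space_at_infinity (x0 X)) (space_at_infinity (x0 Y)),
    (forall (X Y : unboundedMetricType R) (f : coarse_map X Y)
            (A : unbounded_set X),
       Bmap X Y (close_class f) (phi_class A) =
       phi_class (unbounded_image f A)) /\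
    is_functor Bmap.
Proof.
exists (fun X Y c => ProxMap (map_at_infinity_prox (x0 := x0 X) (x0 Y) c)).
split=> [X Y f A|]; first exact: map_at_infinityE.
split=> [X|X Y Z c2 c1]; apply: prox_map_eq => p /=.
  have [A ->] := phi_class_surj p; rewrite map_at_infinityE.
  by apply/phi_classP; rewrite /= image_id; exact: phi_refl.
have [A ->] := phi_class_surj p; have [g ->] := close_class_surj c2.
have [f ->] := close_class_surj c1.
rewrite close_compE !map_at_infinityE; apply/phi_classP => /=.
by rewrite (image_comp f g); exact: phi_refl.
Qed.
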